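(* Let $m\in\mathbb{N}$, $m>1$, and let $\delta_0,\delta_1,\ldots$ be a sequence of real parameters with $1>\delta_l>0$ for all $l$ (characterising the computational error on level $l$). Let $Q$ be a real-valued random variable and let $\tilde Q_0,\tilde Q_1,\ldots$ be real-valued random variables (inexactly computed approximations of $Q$); put $\tilde Y_0:=\tilde Q_0$ and $\tilde Y_l:=\tilde Q_l-\tilde Q_{l-1}$ for $l\ge 1$. Assume that there exist $\alpha_1,\beta_1,\alpha_2,\beta_2>0$ such that $$|\mathbb{E}[\tilde Q_l-Q]|=O\bigl(m^{-\alpha_1 l}+\delta_l^{\alpha_2}\bigr),\qquad \operatorname{var}[\tilde Y_l]=O\bigl(m^{-\beta_1 l}+\delta_l^{\beta_2}\bigr),$$ with implied constants independent of $l$. Then there is a constant $C>0$ such that for every $L\in\mathbb{N}$ and all $N_0,\ldots,N_L\in\mathbb{N}$ (positive), the mixed-precision multilevel Monte Carlo estimator $\widehat{Q}^{\mathrm{MPML}}_{L,\{N_l\}}$ satisfies $$\mathbb{E}\Bigl[\bigl(\mathbb{E}[Q]-\widehat{Q}^{\mathrm{MPML}}_{L,\{N_l\}}\bigr)^2\Bigr]\le C\left(\Bigl(m^{-2\alpha_1 L}+\sum_{l=0}^L\frac{m^{-\beta_1 l}}{N_l}\Bigr)+\Bigl(m^{-\alpha_1 L}\delta_L^{\alpha_2}+\delta_L^{2\alpha_2}+\sum_{l=0}^L\frac{\delta_l^{\beta_2}}{N_l}\Bigr)\right).$$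
   Context: All random variables are defined on a probability space and have the finite moments needed for the expectations and variances in the statement to make sense. The mixed-precision multilevel Monte Carlo (MPML) estimator is $\widehat{Q}^{\mathrm{MPML}}_{L,\{N_l\}}:=\sum_{l=0}^L\widehat Y_l$ with $\widehat Y_l:=\frac1{N_l}\sum_{k=1}^{N_l}\tilde Y_l^{(k)}$, where for each $l$ the $\tilde Y_l^{(k)}$, $k=1,\dots,N_l$, are i.i.d. copies of $\tilde Y_l$ (i.e. of $\tilde Q_0$ if $l=0$, and of $\tilde Q_l-\tilde Q_{l-1}$, both evaluated at the same random sample, if $l\ge1$), and the estimators $\widehat Y_0,\dots,\widehat Y_L$ are independent of each other. *)

(* Defs.v *)
From mathcomp Require Export all_boot all_order all_algebra.
From mathcomp Require Export all_classical all_reals all_analysis.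
Export Order.TTheory GRing.Theory Num.Theory numFieldNormedType.Exports.

Set Implicit Arguments.
Unset Strict Implicit.
Unset Printing Implicit Defensive.

Local Open Scope classical_set_scope.
Local Open Scope ring_scope.

(* The product rule over every finite subfamily; it is meant for families of
   measurable functions, for which all the preimages are events. *)
Definition mutually_independent d (T : measurableType d) (R : realType)
    (P : probability T R) (I : finType) (X : I -> T -> R) : Prop :=
  forall (J : {set I}) (A : I -> set R), (forall i, measurable (A i)) ->
    P (\bigcap_(i in [set i | i \in J]) (X i @^-1` A i)) =
    (\prod_(i in J) P (X i @^-1` A i))%E.

(* Only Borel sets are compared: the value of a measure on a non-measurable set
   carries no information. *)
Definition same_distribution d d' (T : measurableType d)
    (T' : measurableType d') (R : realType) (P : probability T R)
    (P' : probability T' R) (X : T -> R) (X' : T' -> R) : Prop :=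
  forall A : set R, measurable A -> pushforward P X A = pushforward P' X' A.

Section mpml.
Context d (T : measurableType d) (R : realType) (P : probability T R).

Definition level_correction (Qt : nat -> {RV P >-> R}) (l : nat) :
    T -> R :=
  if l is l'.+1 then Qt l'.+1 \- Qt l' else Qt 0%N.

(* Y l k is the k-th sample on level l; the samples are numbered from 0 and only
   those with k < N l are used. *)
Definition level_estimator (N : nat -> nat) (Y : nat -> nat -> {RV P >-> R})
    (l : nat) : T -> R :=
  fun w => (N l)%:R^-1 * \sum_(k < N l) Y l k w.

Definition mpml_estimator (L : nat) (N : nat -> nat)
    (Y : nat -> nat -> {RV P >-> R}) : T -> R :=
  fun w => \sum_(l < L.+1) level_estimator N Y l w.

End mpml.

(* Y is a family of samples from which the estimator with levels 0, ..., L can be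
   formed: i.i.d. copies of the correction within each level, and level
   estimators that are independent of each other. The samples may live on another
   probability space than Qt. *)
Definition mpml_samples d d' (T : measurableType d) (T' : measurableType d')
    (R : realType) (P : probability T R) (P' : probability T' R)
    (Qt : nat -> {RV P >-> R}) (L : nat) (N : nat -> nat)
    (Y : nat -> nat -> {RV P' >-> R}) : Prop :=
  [/\ forall l k, (l <= L)%N -> (k < N l)%N ->
        same_distribution P' P (Y l k) (level_correction Qt l),
      forall l, (l <= L)%N ->
        mutually_independent P' (fun k : 'I_(N l) => Y l k : T' -> R)
    & mutually_independent P' (fun l : 'I_L.+1 => level_estimator N Y l)].

(* Main.v *)
(* The mean square error is the variance of the estimator plus the square of its
   bias. The expectations of the corrections telescope, so that the bias is
   E[Q] - E[Qt L], and (a + b)^2 <= 2 (a^2 + a b + b^2) for a, b >= 0.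
   Independent square-integrable variables are uncorrelated, so that the
   variance is the sum over the levels l of the variance of the correction
   divided by N l. *)

From HB Require Import structures.
Require Import Defs.
From mathcomp Require Import measurable_realfun ring lra.

Set Implicit Arguments.
Unset Strict Implicit.
Unset Printing Implicit Defensive.

Local Open Scope classical_set_scope.
Local Open Scope ring_scope.

(** * Moments of identically distributed variables on two probability spaces *)

Section same_distribution_theory.
Context d d' (T : measurableType d) (T' : measurableType d') (R : realType).
Variables (P : probability T R) (P' : probability T' R).
Variables (X : T -> R) (X' : T' -> R).
Hypotheses (mX : measurable_fun setT X) (mX' : measurable_fun setT X').
Hypothesis XX' : same_distribution P P' X X'.

(** By change of variables both sides are integrals of [f] against the laws of [X] and [X'], which
    agree on Borel sets. Nonnegativity replaces integrability, so the result can itself be used to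
    prove that moments are finite. *)
Lemma same_distribution_ge0_integral (f : R -> \bar R) :
  measurable_fun setT f -> (forall x, 0 <= f x)%E ->
  (\int[P]_w f (X w) = \int[P']_w f (X' w))%E.
Proof.
move=> mf f0.
rewrite -[LHS](@ge0_integral_pushforward _ _ _ _ _ X mX P setT)//.
rewrite -[RHS](@ge0_integral_pushforward _ _ _ _ _ X' mX' P' setT)//.
by apply: eq_measure_integral => A mA _; exact: XX'.
Qed.

(** The samples are only given as random variables; this supplies their second moments from those of
    the corrections. *)
Lemma same_distribution_Lfun2 : X' \in Lfun P' 2%:E -> X \in Lfun P 2%:E.
Proof.
rewrite !inE => /andP[_]; rewrite inE/= => N'.
apply/andP; split; rewrite inE//=.
move: N'; rewrite /finite_norm unlock /=.
rewrite (@same_distribution_ge0_integral (fun x => (`|x| `^ 2)%:E))//.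
  apply/measurable_EFinP.
  exact: (measurableT_comp (measurable_powR _)).
Qed.

Lemma same_distribution_expectation : X \in Lfun P 1 -> X' \in Lfun P' 1 ->
  ('E_P[X] = 'E_P'[X'])%E.
Proof.
move=> /Lfun1_integrable iX /Lfun1_integrable iX'; rewrite unlock.
rewrite -[LHS](@integral_pushforward _ _ _ _ _ X mX P setT EFin)//.
rewrite -[RHS](@integral_pushforward _ _ _ _ _ X' mX' P' setT EFin)//.
by apply: eq_measure_integral => A mA _; exact: XX'.
Qed.

(** Once the means are identified, both variances integrate the same nonnegative function, the
    squared distance to the common mean [c]. *)
Lemma same_distribution_variance : X \in Lfun P 1 -> X' \in Lfun P' 1 ->
  ('V_P[X] = 'V_P'[X'])%E.
Proof.
move=> iX iX'.
rewrite /variance !covariance.unlock (same_distribution_expectation iX iX').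
rewrite unlock.
set c := fine _.
apply: (@same_distribution_ge0_integral
  (fun x => ((x - c) * (x - c))%:E)).
- apply/measurable_EFinP; apply: measurable_funM; exact: measurable_funB.
- by move=> x; rewrite lee_fin -expr2 sqr_ge0.
Qed.

End same_distribution_theory.

(** * Independence implies zero covariance *)

Section independence.
Context d (T : measurableType d) (R : realType) (P : probability T R).

(* The law of (X, Y) is the product of the laws of X and Y, since the two agree
   on rectangles; Fubini's theorem then factors the integral of x * y. *)
Lemma expectation_mul_independent (X Y : T -> R) :
  X \in Lfun P 2%:E -> Y \in Lfun P 2%:E ->
  (forall A B, measurable A -> measurable B ->
    P (X @^-1` A `&` Y @^-1` B) = (P (X @^-1` A) * P (Y @^-1` B))%E) ->
  ('E_P[(X * Y)%R] = 'E_P[X] * 'E_P[Y])%E.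
Proof.
move=> X2 Y2 XY.
have PT : P setT \is a fin_num by exact: fin_num_measure.
have iX := (Lfun1_integrable _ _).1 (Lfun_subset12 PT X2).
have iY := (Lfun1_integrable _ _).1 (Lfun_subset12 PT Y2).
have iXY := (Lfun1_integrable _ _).1 (Lfun2_mul_Lfun1 X2 Y2).
have mX : measurable_fun setT X by apply/measurable_EFinP; case/integrableP: iX.
have mY : measurable_fun setT Y by apply/measurable_EFinP; case/integrableP: iY.
pose Z w := (X w, Y w).
have mZ : measurable_fun setT Z by exact/measurable_fun_pair.
pose X' : {mfun T >-> R} := HB.pack X (isMeasurableFun.Build _ _ _ _ _ mX).
pose Y' : {mfun T >-> R} := HB.pack Y (isMeasurableFun.Build _ _ _ _ _ mY).
pose Z' : {mfun T >-> (R * R)%type} :=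
  HB.pack Z (isMeasurableFun.Build _ _ _ _ _ mZ).
pose f (z : R * R) : \bar R := (z.1 * z.2)%:E.
have mf : measurable_fun setT f.
  by apply/measurable_EFinP; apply: measurable_funM.
have law A : measurable A ->
    (distribution P X' \x distribution P Y')%E A = distribution P Z' A.
  by apply: product_measure_unique => B C mB mC; rewrite -XY.
have fE : (\int[distribution P X' \x distribution P Y']_z f z =
    \int[distribution P Z']_z f z)%E.
  by apply: eq_measure_integral => A mA _; exact: law.
have ifZ : (distribution P Z').-integrable setT f.
  exact: integrable_pushforward.
(* Fubini needs integrability against the product of the laws. It is read off the joint law, where
   it amounts to integrability of [X * Y], a product of two square-integrable functions. *)
have ifXY : (distribution P X' \x distribution P Y')%E.-integrable setT f.
  apply/integrableP; split => //.
  rewrite (eq_measure_integral (distribution P Z')); last first.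
    by move=> A mA _; exact: law.
  by case/integrableP: ifZ.
rewrite unlock.
have <- : (\int[distribution P Z']_z f z = \int[P]_w (X w * Y w)%:E)%E.
  exact: integral_pushforward.
rewrite -fE -integral12_prod_meas1//.
have EX : (\int[distribution P X']_x x%:E = \int[P]_w (X w)%:E)%E.
  exact: integral_pushforward.
have EY : (\int[distribution P Y']_x x%:E = \int[P]_w (Y w)%:E)%E.
  exact: integral_pushforward.
have iX' : (distribution P X').-integrable setT (EFin : R -> \bar R).
  exact: integrable_pushforward.
have iY' : (distribution P Y').-integrable setT (EFin : R -> \bar R).
  exact: integrable_pushforward.
rewrite -EX -EY /fubini_F.
have finEY : (\int[distribution P Y']_y y%:E)%E \is a fin_num.
  exact: integrable_fin_num.
transitivity (\int[distribution P X']_x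
    (x%:E * \int[distribution P Y']_y y%:E))%E.
  by apply: eq_integral => x _; rewrite -integralZl.
by rewrite -(fineK finEY) integralZr.
Qed.

Lemma mutually_independent_covariance (I : finType) (X : I -> T -> R) i j :
  mutually_independent P X -> (forall k, X k \in Lfun P 2%:E) -> i != j ->
  covariance P (X i) (X j) = 0%E.
Proof.
move=> indX X2 ij.
have PT : P setT \is a fin_num by exact: fin_num_measure.
have X1 k := Lfun_subset12 PT (X2 k).
rewrite covarianceE ?Lfun2_mul_Lfun1// expectation_mul_independent//.
  by rewrite subee// fin_numM ?expectation_fin_num.
move=> A B mA mB.
(* The product rule for the pair [i], [j]: the chosen sets are [A] at [i] and, since [i != j], [B]
   at [j]. *)
have := indX [set i; j]%SET (fun k => if k == i then A else B).
rewrite big_setU1/= ?inE// big_set1 eqxx eq_sym (negbTE ij) => <-; last first.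
  by move=> k; case: ifP.
congr (P _); apply/seteqP; split => w /=.
  move=> [Aw Bw] k /=; rewrite !inE => /orP[] /eqP ->; rewrite ?eqxx//.
  by rewrite eq_sym (negbTE ij).
move=> Aw; split.
  by have := Aw i; rewrite /= !inE eqxx; apply.
by have := Aw j; rewrite /= !inE eqxx orbT eq_sym (negbTE ij); apply.
Qed.

End independence.

(** * Variance and expectation of finite sums *)

Section sums.
Context d (T : measurableType d) (R : realType) (P : probability T R).
Variables (I : finType) (X : I -> T -> R).
Hypothesis X2 : forall i, X i \in Lfun P 2%:E.

Lemma variance_sum_uncorrelated :
  (forall i j, i != j -> covariance P (X i) (X j) = 0%E) ->
  ('V_P[(\sum_i X i)%R] = \sum_i 'V_P[X i])%E.
Proof.
move=> cov0.
have S2 (s : seq I) : \sum_(i <- s) X i \in Lfun P 2%:E.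
  by rewrite rpred_sum ?lee1n// => i _; exact: X2.
(* By additivity of the covariance. The index [i] must not occur in [s], since [X i] may be
   correlated with itself; in the induction below this comes from the enumeration of [I] being
   duplicate-free. *)
have covS i (s : seq I) : i \notin s ->
    covariance P (X i) (\sum_(j <- s) X j) = 0%E.
  elim: s => [_|j s IH]; first by rewrite big_nil covariance_cst_r.
  rewrite inE negb_or => /andP[ij /IH is0].
  by rewrite big_cons covarianceDr// cov0// is0 adde0.
elim: (index_enum I) (index_enum_uniq I) => [_|i s IH /= /andP[si us]].
  by rewrite !big_nil variance_cst.
by rewrite !big_cons varianceD// covS// mule0 adde0 IH.
Qed.

Lemma expectation_sum_fin :
  ('E_P[(\sum_i X i)%R] = \sum_i 'E_P[X i])%E.
Proof.
have PT : P setT \is a fin_num by exact: fin_num_measure.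
have -> : \sum_i X i = \sum_(f <- [seq X i | i : I]) f by rewrite big_image.
rewrite expectation_sum ?big_image// => _ /mapP[i _ ->].
exact: Lfun_subset12.
Qed.

End sums.

(** Bias-variance decomposition: for [D = q - S], the variance of [D] is that of [S] and equals the
    mean of [D ^+ 2] minus the square of the mean of [D]. *)
Lemma mean_square_error d (T : measurableType d) (R : realType)
    (P : probability T R) (S : T -> R) (q : R) :
  S \in Lfun P 2%:E ->
  ('E_P[(fun w => (q - S w) ^+ 2)%R] =
    'V_P[S] + ((q - fine 'E_P[S]) ^+ 2)%:E)%E.
Proof.
move=> S2.
have PT : P setT \is a fin_num by exact: fin_num_measure.
have S1 := Lfun_subset12 PT S2.
have D2 : cst q \- S \in Lfun P 2%:E by rewrite rpredB ?lee1n//= Lfun_cst.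
have -> : (fun w => (q - S w) ^+ 2) = (cst q \- S) ^+ 2.
  by apply/funext => w; rewrite !expr2.
rewrite -(varianceB_cst_l q S2) varianceE//.
rewrite expectationB ?Lfun_cst// expectation_cst.
rewrite -(fineK (expectation_fin_num S1)) -EFinB -EFin_expe.
by rewrite subeK.
Qed.

(** * Mean and variance of a sample average *)

Section sample_mean.
Context d d' (T : measurableType d) (T' : measurableType d') (R : realType).
Variables (P : probability T R) (P' : probability T' R).
Variables (n : nat) (X : 'I_n -> T' -> R) (Z : T -> R).
Hypotheses (n_gt0 : (0 < n)%N) (mX : forall i, measurable_fun setT (X i)).
Hypotheses (Z2 : Z \in Lfun P 2%:E).
Hypothesis XZ : forall i, same_distribution P' P (X i) Z.

Let mean : T' -> R := fun w => n%:R^-1 * \sum_i X i w.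

Let mZ : measurable_fun setT Z.
Proof. by move: Z2; rewrite inE => /andP[]; rewrite inE. Qed.

Let X2 i : X i \in Lfun P' 2%:E.
Proof. exact: same_distribution_Lfun2 (XZ i) Z2. Qed.

Let S2 : \sum_i X i \in Lfun P' 2%:E.
Proof. by rewrite rpred_sum ?lee1n// => i _; exact: X2. Qed.

Let meanE : mean = n%:R^-1 \o* \sum_i X i.
Proof. by apply/funext => w; rewrite /mean /= mulrC fct_sumE. Qed.

Lemma sample_mean_Lfun2 : mean \in Lfun P' 2%:E.
Proof. by rewrite meanE Lfun_scale// ler1n. Qed.

Let Z1 : Z \in Lfun P 1.
Proof. exact: Lfun_subset12 (fin_num_measure P _ measurableT) _ Z2. Qed.

Let X1 i : X i \in Lfun P' 1.
Proof. exact: Lfun_subset12 (fin_num_measure P' _ measurableT) _ (X2 i). Qed.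

Lemma expectation_sample_mean : ('E_P'[mean] = 'E_P[Z])%E.
Proof.
rewrite meanE expectationZl; last first.
  exact: Lfun_subset12 (fin_num_measure P' _ measurableT) _ S2.
rewrite expectation_sum_fin//.
rewrite (eq_bigr (fun=> (fine 'E_P[Z])%:E)) => [|i _]; last first.
  rewrite fineK ?expectation_fin_num//.
  exact: same_distribution_expectation (XZ i) _ _.
rewrite sumEFin sumr_const card_ord -EFinM -(mulr_natl (fine _)) mulKf.
  by rewrite fineK ?expectation_fin_num.
by rewrite pnatr_eq0 -lt0n.
Qed.

Lemma variance_sample_mean : mutually_independent P' X ->
  ('V_P'[mean] = (fine 'V_P[Z] / n%:R)%:E)%E.
Proof.
move=> indX.
rewrite meanE varianceZ// variance_sum_uncorrelated//; last first.
  by move=> i j; exact: mutually_independent_covariance.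
rewrite (eq_bigr (fun=> (fine 'V_P[Z])%:E)) => [|i _]; last first.
  rewrite fineK ?variance_fin_num//.
  exact: same_distribution_variance (XZ i) _ _.
(* The sum contributes a factor [n] and the scaling a factor [n ^- 2], which leaves [1 / n]. *)
rewrite sumEFin sumr_const card_ord -EFinM -(mulr_natl (fine _)) expr2.
rewrite -mulrA mulKf 1?mulrC//.
by rewrite pnatr_eq0 -lt0n.
Qed.

End sample_mean.

(** * Telescoping of the expected corrections *)

Section level_correction.
Context d (T : measurableType d) (R : realType) (P : probability T R).
Variable Qt : nat -> {RV P >-> R}.
Hypothesis hQt : forall l, (Qt l : T -> R) \in Lfun P 2%:E.

Lemma level_correction_Lfun2 l : level_correction Qt l \in Lfun P 2%:E.
Proof. by case: l => [|l] //=; rewrite rpredB ?lee1n. Qed.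

Lemma sum_expectation_level_correction L :
  (\sum_(l < L.+1) 'E_P[level_correction Qt l] = 'E_P[Qt L])%E.
Proof.
have PT : P setT \is a fin_num by exact: fin_num_measure.
have Qt1 l : (Qt l : T -> R) \in Lfun P 1 by exact: Lfun_subset12.
elim: L => [|L IH]; first by rewrite big_ord1.
(* The expectation of [Qt L] cancels; in the extended reals this requires it to be finite. *)
rewrite big_ord_recr/= IH expectationB// [LHS]addeC.
by apply: subeK; exact: expectation_fin_num.
Qed.

End level_correction.

(** * Combination of the bias and variance bounds *)

Theorem theorem4p1 (R : realType) (d : measure_display) (T : measurableType d)
  (P : probability T R) (m : nat) (hm : (1 < m)%N)
  (delta : nat -> R) (hdelta : forall l, 0 < delta l < 1)
  (Q : {RV P >-> R}) (Qt : nat -> {RV P >-> R})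
  (hQ : (Q : T -> R) \in Lfun P 1)
  (hQt : forall l, (Qt l : T -> R) \in Lfun P 2%:E)
  (alpha1 beta1 alpha2 beta2 : R)
  (ha1 : 0 < alpha1) (hb1 : 0 < beta1) (ha2 : 0 < alpha2) (hb2 : 0 < beta2)
  (hbias : exists c : R, forall l : nat,
    (`| 'E_P[(Qt l \- Q : T -> R)] | <=
      (c * (m%:R `^ (- alpha1 * l%:R) + delta l `^ alpha2))%:E)%E)
  (hvar : exists c : R, forall l : nat,
    ('V_P[level_correction Qt l] <=
      (c * (m%:R `^ (- beta1 * l%:R) + delta l `^ beta2))%:E)%E) :
  exists C : R, 0 < C /\
    forall (L : nat) (N : nat -> nat) (hN : forall l, (l <= L)%N -> (0 < N l)%N)
      (d' : measure_display) (T' : measurableType d') (P' : probability T' R)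
      (Y : nat -> nat -> {RV P' >-> R}) (hY : mpml_samples Qt L N Y),
    ('E_P'[(fun w => (fine 'E_P[Q] - mpml_estimator L N Y w) ^+ 2)%R] <=
      (C * ((m%:R `^ (- 2 * alpha1 * L%:R)
              + \sum_(l < L.+1) m%:R `^ (- beta1 * l%:R) / (N l)%:R)
            + (m%:R `^ (- alpha1 * L%:R) * delta L `^ alpha2
              + delta L `^ (2 * alpha2)
              + \sum_(l < L.+1) delta l `^ beta2 / (N l)%:R)))%:E)%E.
Proof.
move: hbias hvar => [cb hcb] [cv hcv].
(* [2 * cb ^+ 2] serves the squared bias and the absolute value of [cv] the variance, as [cv] has no
   known sign; the summand 1 makes [C] positive. *)
pose C := 1 + 2 * cb ^+ 2 + `|cv|.
have C_gt0 : 0 < C.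
  by rewrite /C -addrA ltr_pwDl// addr_ge0// mulr_ge0// sqr_ge0.
exists C; split=> // L N hN d' T' P' Y [YQ indY indL].
have PT : P setT \is a fin_num by exact: fin_num_measure.
have Z2 := level_correction_Lfun2 hQt.
have YQ' (l : 'I_L.+1) (k : 'I_(N l)) :
    same_distribution P' P (Y l k) (level_correction Qt l).
  by apply: YQ => //; rewrite -ltnS.
have N0 (l : 'I_L.+1) : (0 < N l)%N by apply: hN; rewrite -ltnS.
have est2 (l : 'I_L.+1) : level_estimator N Y l \in Lfun P' 2%:E.
  by apply: (sample_mean_Lfun2 (P := P) _ (Z2 l) (YQ' l)).
have -> : mpml_estimator L N Y = \sum_(l < L.+1) level_estimator N Y l.
  by apply/funext => w; rewrite fct_sumE.
rewrite mean_square_error; last first.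
  by rewrite rpred_sum ?lee1n.
rewrite expectation_sum_fin// variance_sum_uncorrelated//; last first.
  by move=> i j; exact: (mutually_independent_covariance indL est2).
have estE (l : 'I_L.+1) :
    ('E_P'[level_estimator N Y l] = 'E_P[level_correction Qt l])%E.
  exact: (expectation_sample_mean (N0 l) _ (Z2 l) (YQ' l)).
have estV (l : 'I_L.+1) : ('V_P'[level_estimator N Y l] =
    (fine 'V_P[level_correction Qt l] / (N l)%:R)%:E)%E.
  apply: (variance_sample_mean (N0 l) _ (Z2 l) (YQ' l)) => //.
  by apply: indY; rewrite -ltnS.
rewrite (eq_bigr _ (fun l _ => estE l)) (eq_bigr _ (fun l _ => estV l)).
rewrite sum_expectation_level_correction// sumEFin -EFinD lee_fin.
have QtL1 : (Qt L : T -> R) \in Lfun P 1 by exact: Lfun_subset12.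
(* In these terms the bias part of the bound is [a ^+ 2 + a * b + b ^+ 2]. *)
set a := m%:R `^ (- alpha1 * L%:R); set b := delta L `^ alpha2.
have a0 : 0 <= a by exact: powR_ge0.
have b0 : 0 <= b by exact: powR_ge0.
have -> : m%:R `^ (- 2 * alpha1 * L%:R) = a ^+ 2.
  rewrite /a -powR_mulrn ?powR_ge0// -powRrM; congr (_ `^ _); ring.
have -> : delta L `^ (2 * alpha2) = b ^+ 2.
  by rewrite /b -powR_mulrn ?powR_ge0// -powRrM mulrC.
have bias : (fine 'E_P[Q] - fine 'E_P[Qt L]) ^+ 2 <= cb ^+ 2 * (a + b) ^+ 2.
  have := hcb L; rewrite expectationB//.
  rewrite -(fineK (expectation_fin_num hQ)) -(fineK (expectation_fin_num QtL1)).
  rewrite -EFinB /= lee_fin distrC -/a -/b => h.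
  (* The sign of [cb] is unknown, but [cb * (a + b)] bounds an absolute value and is thus
     nonnegative, so [h] may be squared. *)
  rewrite -exprMn -[leLHS]real_normK ?num_real//.
  by rewrite lerXn2r ?nnegrE// (le_trans _ h).
have var : \sum_(l < L.+1) fine 'V_P[level_correction Qt l] / (N l)%:R <=
    C * (\sum_(l < L.+1) m%:R `^ (- beta1 * l%:R) / (N l)%:R
       + \sum_(l < L.+1) delta l `^ beta2 / (N l)%:R).
  (* Level by level: the positive factor [1 / N l] cancels, and the variance hypothesis applies with
     [cv <= C]. *)
  rewrite -big_split mulr_sumr; apply: ler_sum => l _ /=.
  rewrite -mulrDl mulrA ler_pM2r ?invr_gt0 ?ltr0n//.
  have := hcv l; rewrite -(fineK (variance_fin_num (Z2 l))) lee_fin.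
  move/le_trans; apply; rewrite ler_wpM2r ?addr_ge0 ?powR_ge0//.
  by rewrite (le_trans (ler_norm _))// /C lerDr addr_ge0// mulr_ge0// sqr_ge0.
have Ccb : 2 * cb ^+ 2 <= C.
  by rewrite /C -addrA (addrC 1) -addrA lerDl addr_ge0.
(* The products given to [nra] make the goal linear: [2 * cb ^+ 2 * (a ^+ 2 + a * b + b ^+ 2)]
   exceeds [cb ^+ 2 * (a + b) ^+ 2] by [cb ^+ 2 * a ^+ 2 + cb ^+ 2 * b ^+ 2]. *)
have := ler_wpM2r
  (addr_ge0 (addr_ge0 (sqr_ge0 a) (mulr_ge0 a0 b0)) (sqr_ge0 b)) Ccb.
have := mulr_ge0 (sqr_ge0 cb) (sqr_ge0 a).
have := mulr_ge0 (sqr_ge0 cb) (sqr_ge0 b).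
nra.
Qed.
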